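(* Let $D$ be a weakly connected finite digraph (loops allowed, no parallel arcs) with $|V(D)|\ge 2$, and set $m=|A(D)|$. If $D$ does not have loops, or if $D$ has loops and $Z(L(D))>0$, then $$F(L(D))=\begin{cases}0 & \text{if } D \text{ is a directed cycle},\\ m-1 & \text{if } D\text{ has a source},\\ m-2 & \text{otherwise.}\end{cases}$$
   Context: A digraph $D=(V,A)$ has finite vertex set $V$ and arc set $A\subseteq V\times V$; an arc $(u,v)$ has tail $u$ and head $v$; a loop is an arc $(u,u)$. $N_D^+(v)=\{u:(v,u)\in A\}$, $N_D^-(v)=\{u:(u,v)\in A\}$ (so if $(u,u)\in A$ then $u\in N_D^+(u)$ and $u\in N_D^-(u)$). A source is a vertex with $N_D^-(v)=\emptyset$. $D$ is weakly connected if its underlying undirected graph is connected. $D$ is a directed cycle if its vertices can be labeled $v_1,\dots,v_n$ so that its arcs are exactly $(v_1,v_2),\dots,(v_{n-1},v_n),(v_n,v_1)$. The line digraph $L(D)$ has vertex set $V(L(D))=A(D)$ and an arc from $a$ to $b$ exactly when the head of $a$ is the tail of $b$ in $D$. Zero forcing on a digraph $H$ without loops: for $S\subseteq V(H)$, $B^0(S)=S$ and $B^{i+1}(S)=B^i(S)\cup\{w:\{w\}=N_H^+(v)\setminus B^i(S)\text{ for some }v\in B^i(S)\}$. On a digraph $H$ with (at least one) loop, the rule is instead $B^{i+1}(S)=B^i(S)\cup\{w:\{w\}=N_H^+(v)\setminus B^i(S)\text{ for some }v\in V(H)\}$. In either case $S$ is a zero forcing set (ZFS) if $B^t(S)=V(H)$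 for some $t\ge 0$, and a failed zero forcing set (FZFS) otherwise. $Z(H)$ is the smallest cardinality of a ZFS (possibly $0$ when $H$ has loops); $F(H)$ is the largest cardinality of an FZFS (for $H$ with loops, it is undefined exactly when $Z(H)=0$). *)

(* Defs.v *)
From mathcomp Require Import all_boot.

Set Implicit Arguments.
Unset Strict Implicit.
Unset Printing Implicit Defensive.

(* A digraph on V without parallel arcs is its arc set A : {set V * V}; the
   arc (u, v) has tail u and head v, and loops (u, u) are allowed. *)

Section Digraph.
Variables (V : finType) (A : {set V * V}).

Definition out_nbrs (v : V) : {set V} := [set u | (v, u) \in A].
Definition in_nbrs (v : V) : {set V} := [set u | (u, v) \in A].

Definition has_loop : bool := [exists v, (v, v) \in A].
Definition has_source : bool := [exists v, in_nbrs v == set0].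

Definition weakly_connected : Prop :=
  forall u v, connect (fun x y => ((x, y) \in A) || ((y, x) \in A)) u v.

(* [ordS] is the cyclic successor of ['I_n]. *)
Definition directed_cycle : Prop :=
  exists f : 'I_#|V| -> V,
    bijective f /\ A = [set (f i, f (ordS i)) | i : 'I_#|V|].

(* Without loops only vertices of S may force; as soon as the digraph has a
   loop, every vertex may. *)
Definition force_step (S : {set V}) : {set V} :=
  S :|: [set w | [exists v, (has_loop || (v \in S))
                            && ([set w] == out_nbrs v :\: S)]].

Definition forced (t : nat) (S : {set V}) : {set V} := iter t force_step S.

Definition zero_forcing (S : {set V}) : Prop := exists t, forced t S = setT.

Lemma forced_mono (s t : nat) (S : {set V}) :
  s <= t -> forced s S \subset forced t S.
Proof.
move=> /subnK <-; elim: (t - s) => [|k IHk] //.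
by apply: subset_trans IHk _; rewrite addSn; apply: subsetUl.
Qed.

Lemma forced_stable (S : {set V}) (t : nat) : forced t S \subset forced #|V| S.
Proof.
have [i [le_iV fix_i]] : exists i, i <= #|V| /\ forced i.+1 S = forced i S.
  have [/existsP [i /eqP Ei]|/existsPn nfix] :=
    boolP [exists i : 'I_#|V|.+1, forced i.+1 S == forced i S].
    by exists i; split=> //; rewrite -ltnS.
  suff card_ge k : k <= #|V|.+1 -> k <= #|forced k S|.
    by have := leq_trans (card_ge _ (leqnn _)) (max_card _); rewrite ltnn.
  elim: k => [|k IHk] // ltkV.
  apply: leq_ltn_trans (IHk (ltnW ltkV)) _; apply: proper_card.
  by rewrite properEneq forced_mono // eq_sym (nfix (Ordinal ltkV)).
have stop k : forced (k + i) S = forced i S.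
  by elim: k => [|k IHk] //; rewrite addSn -[RHS]fix_i /= -/(forced _ _) IHk.
have [le_ti|/ltnW /subnK <-] := leqP t i.
  exact: forced_mono (leq_trans le_ti le_iV).
by rewrite stop forced_mono.
Qed.

Lemma zero_forcingP (S : {set V}) :
  reflect (zero_forcing S) (forced #|V| S == setT).
Proof.
apply: (iffP eqP) => [ZS|[t ZS]]; first by exists #|V|.
by apply/eqP; rewrite -subTset -ZS forced_stable.
Qed.

Definition zero_forcing_dec (S : {set V}) : decidable (zero_forcing S) :=
  decP (zero_forcingP S).

(* The whole vertex set is zero forcing, so this minimum is always attained. *)
Definition zero_forcing_number : nat :=
  #|[arg min_(S < setT | zero_forcing_dec S) #|S| ]|.

(* [None] when every set of vertices is zero forcing. *)
Definition failed_zero_forcing_number : option nat :=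
  if [exists S : {set V}, ~~ zero_forcing_dec S]
  then Some (\max_(S : {set V} | ~~ zero_forcing_dec S) #|S|)
  else None.

Definition line_digraph : {set {a | a \in A} * {a | a \in A}} :=
  [set ab | (val ab.1).2 == (val ab.2).1].

End Digraph.

(* Main.v *)
Require Import Defs.
From mathcomp Require Import all_boot zify.

Set Implicit Arguments.
Unset Strict Implicit.
Unset Printing Implicit Defensive.

(** A nonempty set [C] of vertices that meets no out-neighbourhood in exactly
    one vertex can never be entered by a force, so its complement fails.  In
    [L(D)] every out-neighbourhood is the set of all arcs out of some vertex of
    [D].  Hence an arc out of a source, or a pair of arcs with a common tail,
    is such a set.  If [D] has no source then every arc is an out-neighbour in
    [L(D)], and a set missing a single arc is zero forcing.  If moreover no two
    arcs share a tail, then [D] is the graph of a permutation, and weak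
    connectedness makes this permutation a single cycle. *)

Section ZeroForcing.
Variables (V : finType) (A : {set V * V}).

Lemma failed_zero_forcing_number_eq (S : {set V}) (k : nat) :
  ~ zero_forcing A S -> #|S| = k ->
  (forall T, ~ zero_forcing A T -> #|T| <= k) ->
  failed_zero_forcing_number A = Some k.
Proof.
move=> failS cardS maxk; rewrite /failed_zero_forcing_number.
have failSb : ~~ zero_forcing_dec A S by case: zero_forcing_dec.
rewrite ifT; last by apply/existsP; exists S.
congr Some; apply/eqP; rewrite eqn_leq; apply/andP; split.
  by apply/bigmax_leqP => T; case: zero_forcing_dec => // failT _; apply: maxk.
by rewrite -cardS; apply: (leq_bigmax_cond (F := fun T : {set V} => #|T|)).
Qed.

Lemma stable_failed (S : {set V}) :
  force_step A S = S -> S != setT -> ~ zero_forcing A S.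
Proof.
move=> stS /eqP nST [t ftS]; apply: nST; rewrite -ftS.
by elim: t {ftS} => [|t IHt] //=; rewrite -IHt.
Qed.

(** The condition ranges over every [v], inside [C] or not, so it blocks forces under both rules,
    with and without loops. *)
Lemma setC_failed (C : {set V}) :
  C != set0 -> (forall v, #|out_nbrs A v :&: C| != 1) ->
  ~ zero_forcing A (~: C).
Proof.
move=> C0 fortC; apply: stable_failed; last by rewrite -setC0 (inj_eq (@setC_inj _)).
apply/setUidPl/subsetP => w; rewrite inE => /existsP [v /andP [_ /eqP Ew]].
by have := fortC v; rewrite -(setCK C) -setDE -Ew cards1.
Qed.

(** Only [w] is missing, so [v] forces it in one round. Without loops the forcing vertex must lie in
    the set, whence [v != w]; with a loop somewhere, [w] may even force itself. *)
Lemma zero_forcing_setC1 (v w : V) :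
  w \in out_nbrs A v -> has_loop A || (v != w) -> zero_forcing A (~: [set w]).
Proof.
move=> vw lvw; exists 1; apply/eqP; rewrite -subTset; apply/subsetP => x _.
have [->|xw] := eqVneq x w; rewrite !inE ?xw // eqxx /=.
apply/existsP; exists v; rewrite !inE lvw /=.
apply/eqP/setP => y; rewrite in_setD !in_set1 in_setC in_set1 negbK.
by have [->|] := eqVneq y w; rewrite ?vw.
Qed.

Lemma forced_fixed (S : {set V}) :
  force_step A (forced A #|V| S) = forced A #|V| S.
Proof.
apply/eqP; rewrite eqEsubset; apply/andP; split; last exact: subsetUl.
exact: (forced_stable A S #|V|.+1).
Qed.

End ZeroForcing.

Section LineDigraph.
Variables (V : finType) (A : {set V * V}).
Let L := line_digraph A.

Lemma card_arcs : #|{: {a | a \in A}}| = #|A|.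
Proof. by rewrite card_sig; apply: eq_card => a; rewrite !inE. Qed.

Lemma in_out_nbrs_line (a b : {a | a \in A}) :
  (b \in out_nbrs L a) = ((val a).2 == (val b).1).
Proof. by rewrite !inE. Qed.

Lemma card_failed_le (S : {set {a | a \in A}}) :
  ~ zero_forcing L S -> #|S| <= #|A| - 1.
Proof.
move=> failS; rewrite -card_arcs subn1 -ltnS.
have ltS : #|S| < #|{: {a | a \in A}}|.
  rewrite ltn_neqAle max_card andbT; apply/negP => /eqP ES; apply: failS.
  by exists 0; apply/eqP; rewrite eqEcard subsetT cardsT ES leqnn.
by rewrite prednK // (leq_ltn_trans _ ltS).
Qed.

Lemma line_failed_source (cardV : 2 <= #|V|) :
  weakly_connected A -> has_source A ->
  failed_zero_forcing_number L = Some (#|A| - 1).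
Proof.
move=> connA /existsP [v /eqP srcv].
have nin u : (u, v) \in A = false.
  by have := in_set0 u; rewrite -srcv inE.
(* A second vertex is joined to [v] by an undirected path; its first edge at [v] must be an arc out
   of [v], since none enters a source. *)
have [w vw] : exists w, (v, w) \in A.
  have [u nuv] : exists u, u != v.
    apply/existsP; apply: contraTT cardV => /existsPn all_v.
    rewrite -leqNgt -(card1 v); apply: subset_leq_card.
    by apply/subsetP => u _; rewrite inE -[_ == _]negbK all_v.
  have /connectP [[|x p] /= pth lst] := connA v u.
    by rewrite lst eqxx in nuv.
  by case/andP: pth; rewrite nin orbF; exists x.
pose a : {a | a \in A} := Sub (v, w) vw.
apply: (@failed_zero_forcing_number_eq _ _ (~: [set a])).
- apply: setC_failed => [|b].
    by apply/set0Pn; exists a; rewrite set11.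
  suff -> : out_nbrs L b :&: [set a] = set0 by rewrite cards0.
  apply/setP => c; rewrite in_setI in_out_nbrs_line in_set1 in_set0.
  apply/negP => /andP [/eqP bc /eqP Ec]; move: bc; rewrite Ec /= => bv.
  by case: b bv => -[x y] /= xyA Ey; rewrite Ey nin in xyA.
- by rewrite cardsC1 card_arcs subn1.
exact: card_failed_le.
Qed.

Lemma zero_forcing_line_setC1 (a : {a | a \in A}) :
  ~~ has_source A -> zero_forcing L (~: [set a]).
Proof.
move=> /existsPn nsrc; case: a => -[u v] uv.
have /set0Pn [x] := nsrc u; rewrite inE => xu.
apply: (@zero_forcing_setC1 _ _ (Sub (x, u) xu)).
  by rewrite in_out_nbrs_line.
(* If the arc into [u] is the missing arc itself, that arc is a loop of the digraph, hence carries a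
   loop of [L], and it may force itself. *)
have [[_ Euv]|_] := eqVneq (Sub (x, u) xu : {a | a \in A}) (exist _ (u, v) uv);
  last by rewrite orbT.
rewrite orbF; apply/existsP; exists (exist _ (u, v) uv).
by rewrite inE /= Euv.
Qed.

Lemma line_failed_common_tail (u v w : V) :
  ~~ has_source A -> (u, v) \in A -> (u, w) \in A -> v != w ->
  failed_zero_forcing_number L = Some (#|A| - 2).
Proof.
move=> nsrc uv uw nvw.
pose a : {a | a \in A} := Sub (u, v) uv.
pose b : {a | a \in A} := Sub (u, w) uw.
have nab : a != b by rewrite -val_eqE /= xpair_eqE eqxx.
apply: (@failed_zero_forcing_number_eq _ _ (~: [set a; b])).
- apply: setC_failed => [|c]; first by apply/set0Pn; exists a; rewrite set21.
  (* An arc with head [u] has both [a] and [b] as out-neighbours; any other arc has neither. *)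
  have [cu|ncu] := eqVneq (val c).2 u.
    suff /setIidPr -> : [set a; b] \subset out_nbrs L c by rewrite cards2 nab.
    by apply/subsetP => d /set2P [] ->; rewrite in_out_nbrs_line cu.
  suff -> : out_nbrs L c :&: [set a; b] = set0 by rewrite cards0.
  apply/setP => d; rewrite in_setI in_out_nbrs_line in_set2 in_set0.
  by apply/negP => /andP [/[swap] /orP [] /eqP -> /=]; rewrite (negPf ncu).
- by rewrite cardsCs setCK cards2 nab card_arcs.
move=> T failT; have leT := card_failed_le failT.
rewrite leqNgt; apply/negP => ltT; apply: failT.
(* A failing set with more than [#|A| - 2] arcs would miss exactly one arc. *)
have /cards1P [c Ec] : #|~: T| == 1.
  have := cardsC T; rewrite card_arcs => ET.
  have A2 : 2 <= #|A|.
    by rewrite -card_arcs -[2]/(true.+1) -nab -cards2 max_card.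
  by move: leT ltT ET A2; move: #|T| #|~: T| #|A| => t c n; lia.
by rewrite -[T]setCK Ec; apply: zero_forcing_line_setC1.
Qed.

End LineDigraph.

(** The orbit of [x] is all of [V], so the iterates of [h] at [x] label the vertices in cyclic
    order. *)
Lemma fconnect_directed_cycle (V : finType) (h : V -> V) (x : V) :
  injective h -> (forall y, fconnect h x y) ->
  directed_cycle [set (y, h y) | y : V].
Proof.
move=> inj_h conn_h.
have ordx : order h x = #|V| by apply: eq_card => y; rewrite !inE conn_h.
pose f (i : 'I_#|V|) := iter i h x.
have inj_f : injective f.
  move=> i j /(congr1 (findex h x)); rewrite !findex_iter ?ordx ?ltn_ord //.
  exact: val_inj.
have bij_f : bijective f by apply: inj_card_bij inj_f _; rewrite card_ord.
have fS i : f (ordS i) = h (f i).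
  rewrite /f /= -iterS; have [lti|] := ltnP i.+1 #|V|; first by rewrite modn_small.
  (* At the last index [ordS] wraps to 0, matching the return of [h] to [x] after [#|V|]
     iterations. *)
  move=> gei; have -> : i.+1 = #|V| by apply/eqP; rewrite eqn_leq gei ltn_ord.
  by rewrite modnn -ordx iter_order.
exists f; split=> //; have [g _ gK] := bij_f.
apply/setP => -[y z]; apply/imsetP/imsetP => -[].
  by move=> t _ [-> ->]; exists (g t); rewrite ?fS ?gK.
by move=> i _ [-> ->]; exists (f i); rewrite ?fS.
Qed.

(** A choice [g] of predecessors is injective because no two arcs share a tail, hence bijective by
    finiteness, and [A] is the graph of its inverse [h]. *)
Lemma functional_directed_cycle (V : finType) (A : {set V * V}) :
  0 < #|V| -> weakly_connected A -> ~~ has_source A ->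
  (forall u v w, (u, v) \in A -> (u, w) \in A -> v = w) -> directed_cycle A.
Proof.
move=> /card_gt0P [x _] connA /existsPn nsrc funA.
have has_pred v : exists u, (u, v) \in A.
  by have /set0Pn [u] := nsrc v; rewrite inE; exists u.
pose g v := xchoose (has_pred v).
have gA v : (g v, v) \in A := xchooseP (has_pred v).
have inj_g : injective g.
  by move=> v w Eg; apply: (funA (g v)); rewrite ?gA // Eg gA.
have [h gK hK] := injF_bij inj_g.
have EA y z : ((y, z) \in A) = (z == h y).
  have yA : (y, h y) \in A by rewrite -{1}(hK y) gA.
  by apply/idP/eqP => [yz|-> //]; apply: funA yz yA.
have -> : A = [set (y, h y) | y : V].
  apply/setP => -[y z]; rewrite EA; apply/eqP/imsetP => [->|[t _ [-> ->]] //].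
  by exists y.
apply: (@fconnect_directed_cycle _ h x) => [|y]; first exact: can_inj hK.
(* Orbits of an injection on a finite set are cycles, so an arc traversed backwards also stays in
   the orbit. *)
have := connA x y; apply: connect_sub => {y} y z; rewrite !EA.
case/orP => /eqP ->; first exact: fconnect1.
by rewrite fconnect_sym ?fconnect1 //; apply: can_inj hK.
Qed.

(** The line digraph is again a loopless cycle: the empty set forces nothing, while one arc forces
    its successor, and so on all the way round. *)
Lemma line_failed_cycle (V : finType) (A : {set V * V}) :
  2 <= #|V| -> directed_cycle A ->
  failed_zero_forcing_number (line_digraph A) = Some 0.
Proof.
move=> cardV [f [bij_f EA]]; have inj_f := bij_inj bij_f.
have fA i : (f i, f (ordS i)) \in A by rewrite EA imset_f.
pose arc i : {a | a \in A} := Sub (f i, f (ordS i)) (fA i).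
have arcP (a : {a | a \in A}) : exists i, a = arc i.
  case: a => a aA; have := aA; rewrite {1}EA => /imsetP [i _ Ea].
  by exists i; apply: val_inj.
have Eout i : out_nbrs (line_digraph A) (arc i) = [set arc (ordS i)].
  apply/setP => b; have [j ->] := arcP b.
  rewrite in_out_nbrs_line in_set1 -[RHS]val_eqE /= xpair_eqE.
  rewrite !(inj_eq inj_f) eq_sym.
  by have [->|] := eqVneq j (ordS i); rewrite ?eqxx.
have arcS_neq i : arc (ordS i) != arc i.
  rewrite -val_eqE /= xpair_eqE (inj_eq inj_f) -val_eqE /=.
  have [lti|gei] := ltnP i.+1 #|V|; first by rewrite modn_small // gtn_eqF.
  have Ei : i.+1 = #|V| by apply/eqP; rewrite eqn_leq gei ltn_ord.
  (* The last index wraps to 0, which would equal [i] only if [#|V|] were 1. *)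
  rewrite {1}Ei modnn; case: (nat_of_ord i) Ei => // E1.
  by rewrite -E1 in cardV.
have nloop : has_loop (line_digraph A) = false.
  apply/existsP => -[a]; have [i ->] := arcP a => ii.
  have := arcS_neq i; rewrite eq_sym -in_set1 -Eout inE ii //.
pose i0 : 'I_#|V| := Ordinal (ltnW cardV).
apply: (@failed_zero_forcing_number_eq _ _ set0); rewrite ?cards0 //.
  apply: stable_failed; last first.
    by apply/eqP => /setP /(_ (arc i0)); rewrite !inE.
  apply/setP => b; rewrite !inE nloop; apply/existsP => -[a].
  by rewrite in_set0.
move=> S failS; rewrite leqNgt; apply/negP => /card_gt0P [a aS].
apply: failS; exists #|{: {a | a \in A}}|.
have := forced_fixed (line_digraph A) S; set T := forced _ _ _ => ET.
have stepT i : arc i \in T -> arc (ordS i) \in T.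
  move=> iT; rewrite -ET in_setU inE.
  have [//|niT] := boolP (arc (ordS i) \in T); apply/existsP; exists (arc i).
  by rewrite iT orbT Eout eq_sym; apply/eqP/setDidPl; rewrite disjoints1.
have {aS} [i iT] : exists i, arc i \in T.
  have [i Ea] := arcP a; exists i; rewrite -Ea.
  exact: (subsetP (@forced_mono _ (line_digraph A) 0 _ S (leq0n _))).
have iterT k : arc (iter k (@ordS _) i) \in T by elim: k => //= k /stepT.
have iterE k : iter k (@ordS _) i = (i + k) %% #|V| :> nat.
  elim: k => [|k IHk] /=; first by rewrite addn0 modn_small.
  by rewrite IHk -addn1 modnDml addn1 addnS.
apply/setP => b; rewrite in_setT; have [j ->] := arcP b.
(* One full turn is added to [j - i] so that the number of steps is natural even when [j < i]. *)
have <- : iter (#|V| - i + j) (@ordS _) i = j; last exact: iterT.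
apply: val_inj; rewrite /= iterE addnA subnKC ?(ltnW (ltn_ord i)) //.
by rewrite modnDl modn_small.
Qed.

Theorem theorem4p21 (V : finType) (A : {set V * V})
  (connA : weakly_connected A) (cardV : 2 <= #|V|)
  (loopA : ~~ has_loop A \/
           (has_loop A /\ 0 < zero_forcing_number (line_digraph A))) :
  (directed_cycle A ->
     failed_zero_forcing_number (line_digraph A) = Some 0) /\
  (has_source A ->
     failed_zero_forcing_number (line_digraph A) = Some (#|A| - 1)) /\
  (~ directed_cycle A -> ~~ has_source A ->
     failed_zero_forcing_number (line_digraph A) = Some (#|A| - 2)).
Proof.
split; first exact: line_failed_cycle.
split; first exact: line_failed_source.
move=> ncyc nsrc.
have [/existsP [u /existsP [v /existsP [w /and3P [uv uw nvw]]]]|nbranch] :=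
  boolP [exists u, exists v, exists w,
           [&& (u, v) \in A, (u, w) \in A & v != w]].
  exact: line_failed_common_tail uv uw nvw.
case: ncyc; apply: functional_directed_cycle => // [|u v w uv uw].
  exact: ltnW.
apply: contraNeq nbranch => nvw; apply/existsP; exists u.
by apply/existsP; exists v; apply/existsP; exists w; rewrite uv uw.
Qed.
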